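(* The class of sums of bivariates is not closed under composition with permutations of the domain. Precisely, let $F:\{0,1\}^6\to\mathbb Z$, $$F(x_1,\dots,x_6)=\sum_{1\le i<j\le 6}\chi_{x_i=x_j=1},$$ where $\chi_{x_i=x_j=1}$ is $1$ if $x_i=x_j=1$ and $0$ otherwise (so $F$ is a sum of bivariates). Let $p$ be the permutation of $\{0,1,\dots,63\}$ given by the single cycle $$\begin{aligned}p=(&0,8,18,11,54,41,28,26,55,59,48,40,60,24,47,12,33,63,13,22,25,16,23,32,7,36,21,\\&6,1,52,44,50,42,17,10,53,37,14,39,9,58,46,38,51,5,27,56,31,15,49,35,61,45,3,\\&30,19,57,34,4,43,2,62,20,29),\end{aligned}$$ let $\iota:\{0,1\}^6\to\{0,\dots,63\}$ be the decimal coding of binary strings, and let $\tilde p=\iota^{-1}\circ p\circ\iota$, a permutation of $\{0,1\}^6$. Then $F\circ\tilde p$ is not a sum of bivariates.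
   Context: A function $H:\Omega_1\times\dots\times\Omega_n\to\mathbb R$ on a product of finite sets is a sum of bivariates if there are an index set $\mathcal E\subseteq\{(i,j): 1\le i<j\le n\}$ and functions $f_{i,j}:\Omega_i\times\Omega_j\to\mathbb R$, $(i,j)\in\mathcal E$, with $H(x_1,\dots,x_n)=\sum_{(i,j)\in\mathcal E}f_{i,j}(x_i,x_j)$ for all $x$. The decimal coding sends the binary string $x_1x_2\dots x_6$ to the number it represents in base 2, $\iota(x)=\sum_{i=1}^6 x_i2^{6-i}$. In the cycle notation, each listed element is mapped to the next one and the last element ($29$) is mapped to the first ($0$). *)

(* Defs.v *)
(* The real line is an arbitrary R : realType. *)
From HB Require Import structures.
From mathcomp Require Import all_boot all_order all_fingroup all_algebra.
From mathcomp Require Import reals.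

Set Implicit Arguments.
Unset Strict Implicit.
Unset Printing Implicit Defensive.

Import Order.TTheory GRing.Theory Num.Theory.
Local Open Scope ring_scope.

(* The finite functions {dffun forall i, Omega i} are the points of the
   product of the Omega i. *)
Definition sum_of_bivariates (R : realType) (n : nat) (Omega : 'I_n -> finType)
    (H : {dffun forall i : 'I_n, Omega i} -> R) : Prop :=
  exists (E : {set 'I_n * 'I_n}) (f : forall i j : 'I_n, Omega i -> Omega j -> R),
    (forall i j, (i, j) \in E -> (i < j)%N) /\
    forall x, H x = \sum_(e in E) f e.1 e.2 (x e.1) (x e.2).

(* {0,1}^6, in the same form as a general product, with constant factor bool.
   The coordinates x_1, ..., x_6 are x 0, ..., x 5. *)
Definition cube : finType := {dffun forall _ : 'I_6, bool}.

Definition F (x : cube) : int :=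
  \sum_(i < 6) \sum_(j < 6 | (i < j)%N) (x i && x j)%:R.

Definition code_nat (x : cube) : nat := (\sum_(i < 6) x i * 2 ^ (5 - i))%N.

Lemma code_nat_lt x : (code_nat x < 64)%N.
Proof.
rewrite /code_nat !big_ord_recl big_ord0 /=.
by do 6 case: (x _).
Qed.

Definition code (x : cube) : 'I_64 := Ordinal (code_nat_lt x).

Definition decode (k : 'I_64) : cube := [ffun i : 'I_6 => odd (k %/ 2 ^ (5 - i))%N].

Lemma codeK : cancel code decode.
Proof.
move=> x; apply/ffunP => i; rewrite ffunE /= /code_nat !big_ord_recl big_ord0.
case: i => [] [|[|[|[|[|[|//]]]]]] lt_i6 /=;
  [ have -> : Ordinal lt_i6 = ord0 by apply: val_inj
  | have -> : Ordinal lt_i6 = lift ord0 ord0 by apply: val_inj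
  | have -> : Ordinal lt_i6 = lift ord0 (lift ord0 ord0) by apply: val_inj
  | have -> : Ordinal lt_i6 = lift ord0 (lift ord0 (lift ord0 ord0))
      by apply: val_inj
  | have -> : Ordinal lt_i6 = lift ord0 (lift ord0 (lift ord0 (lift ord0 ord0)))
      by apply: val_inj
  | have -> : Ordinal lt_i6 =
      lift ord0 (lift ord0 (lift ord0 (lift ord0 (lift ord0 ord0))))
      by apply: val_inj ];
  by do 6 case: (x _).
Qed.

Lemma decodeK : cancel decode code.
Proof.
move=> k; apply: val_inj; rewrite /= /code_nat !big_ord_recl big_ord0 !ffunE /=.
by case: k => k lt_k; apply/eqP; do 64 (case: k lt_k => [//|k] lt_k).
Qed.

Definition p_cycle_nat : seq nat :=
  [:: 0; 8; 18; 11; 54; 41; 28; 26; 55; 59; 48; 40; 60; 24; 47; 12; 33; 63; 13;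
      22; 25; 16; 23; 32; 7; 36; 21; 6; 1; 52; 44; 50; 42; 17; 10; 53; 37; 14;
      39; 9; 58; 46; 38; 51; 5; 27; 56; 31; 15; 49; 35; 61; 45; 3; 30; 19; 57;
      34; 4; 43; 2; 62; 20; 29]%N.

Definition p_cycle : seq 'I_64 := [seq inord k | k <- p_cycle_nat].

Lemma uniq_p_cycle : uniq p_cycle.
Proof.
rewrite map_inj_in_uniq //.
have lt64 : all (fun k => k < 64)%N p_cycle_nat by [].
move=> k l /(allP lt64) lt_k /(allP lt64) lt_l /(congr1 val) /=.
by rewrite !inordK.
Qed.

(* next c x is the successor of x in c, the last element being sent to the first. *)
Definition p : {perm 'I_64} := perm (can_inj (prev_next uniq_p_cycle)).

Lemma p_tilde_inj : injective (decode \o p \o code).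
Proof.
apply: inj_comp (can_inj codeK); apply: inj_comp (can_inj decodeK) _.
exact: perm_inj.
Qed.

Definition p_tilde : {perm cube} := perm p_tilde_inj.

(* Main.v *)
Require Import Defs.
From HB Require Import structures.
From mathcomp Require Import all_boot all_order all_fingroup all_algebra.
From mathcomp Require Import reals.
From mathcomp Require Import ring.

Set Implicit Arguments.
Unset Strict Implicit.
Unset Printing Implicit Defensive.

Import Order.TTheory GRing.Theory Num.Theory.
Local Open Scope ring_scope.

(** [F] is a sum of bivariates by its very definition.  The obstruction for
    its composition with the permutation is a third-order finite difference.
    Split the coordinates into three blocks, fix two points [x] and [y], and
    consider the eight points obtained by taking, on each block independently,
    either the values of [x] or those of [y].  A bivariate term depends on at
    most two of the three blocks, so switching the remaining block does not
    change it, and its alternating sum over the eight points vanishes; hence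
    so does that of any sum of bivariates ([third_difference_eq0]).  On the
    face of the cube where the last three coordinates vanish, whose points have
    codes 0, 8, ..., 56, the alternating sum for the permuted [F] is nonzero
    ([third_difference_permuted]).  The failure of closure is the special case
    of this permutation of the cube. *)

(** The point that agrees, on the block number [k], with [y] if the [k]-th of
    the three booleans holds, and with [x] otherwise; [blk] sends a coordinate
    to the number of its block. *)
Definition mix (n : nat) (Omega : 'I_n -> finType) (blk : 'I_n -> 'I_3)
    (x y : {dffun forall i : 'I_n, Omega i}) (a b c : bool) :
    {dffun forall i : 'I_n, Omega i} :=
  [ffun i => if nth false [:: a; b; c] (blk i) then y i else x i].

(** The alternating sum of [g] over the vertices of the 3-cube. *)
Definition third_difference (V : zmodType) (g : bool -> bool -> bool -> V) : V :=
  (g true true true - g true true false - g true false true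
     + g true false false)
  - (g false true true - g false true false - g false false true
     + g false false false).

Lemma third_difference_sum (V : zmodType) (I : finType) (P : pred I)
    (g : I -> bool -> bool -> bool -> V) :
  third_difference (fun a b c => \sum_(i | P i) g i a b c) =
  \sum_(i | P i) third_difference (g i).
Proof. by rewrite /third_difference !(sumrB, big_split). Qed.

Lemma third_difference_eq0 (R : realType) (n : nat) (Omega : 'I_n -> finType)
    (H : {dffun forall i : 'I_n, Omega i} -> R) (blk : 'I_n -> 'I_3)
    (x y : {dffun forall i : 'I_n, Omega i}) :
  sum_of_bivariates H ->
  third_difference (fun a b c => H (mix blk x y a b c)) = 0.
Proof.
case=> E [f [_ HE]].
rewrite {1}/third_difference !HE -/(third_difference (fun a b c =>
  \sum_(e in E) f e.1 e.2 (mix blk x y a b c e.1) (mix blk x y a b c e.2))).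
rewrite third_difference_sum big1 // => e _.
rewrite /third_difference !ffunE.
(* In each case, some boolean occurs in neither coordinate of the term. *)
by case: (blk e.1) (blk e.2) => [[|[|[|//]]] ?] [[|[|[|//]]] ?] /=; ring.
Qed.

Lemma sum_of_bivariates_F (R : realType) :
  sum_of_bivariates (Omega := fun _ : 'I_6 => bool)
    (fun x : cube => (F x)%:~R : R).
Proof.
exists [set e : 'I_6 * 'I_6 | (e.1 < e.2)%N], (fun _ _ a b => (a && b)%:R).
split=> [i j|x]; first by rewrite inE.
rewrite /F pair_big_dep /= rmorph_sum /=.
by apply: eq_big => [e|e _]; rewrite ?inE // rmorph_nat.
Qed.

Lemma val_p (k : 'I_64) : p k = next p_cycle_nat k :> nat.
Proof.
rewrite permE -(next_map val_inj uniq_p_cycle); congr (next _ _).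
rewrite /p_cycle -map_comp map_id_in // => j.
have /allP lt64 : all (fun k => k < 64)%N p_cycle_nat by [].
by move/lt64 => /= lt_j; rewrite inordK.
Qed.

(** The value of [F] at the binary string with code [m]: the number of pairs
    among the 1s in the six lowest binary digits of [m]. *)
Definition F_nat (m : nat) : nat :=
  let w := count id [seq odd (m %/ 2 ^ i)%N | i <- iota 0 6] in 'C(w, 2).

Lemma F_p_tilde (x : cube) :
  F (p_tilde x) = (F_nat (next p_cycle_nat (code_nat x)))%:Z.
Proof.
rewrite permE [X in F X]/=.
have <- : p (code x) = next p_cycle_nat (code_nat x) :> nat by exact: val_p.
move: (p _) => k; rewrite /F /F_nat.
under eq_bigr do rewrite big_mkcond.
rewrite !big_ord_recl !big_ord0 /= !ffunE /=.
by do 6 case: (odd _).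
Qed.

(** The face of the cube on which the last three coordinates are 0.  The blocks
    are {0}, {1} and {2, 3, 4, 5}; on coordinates 3, 4, 5 both points are 0, so
    the third boolean affects coordinate 2 only. *)
Definition face (a b c : bool) : cube :=
  @mix 6 (fun=> bool) (fun i => inord (minn i 2))
    [ffun=> false] [ffun i : 'I_6 => (i < 3)%N] a b c.

Lemma code_face (a b c : bool) :
  code_nat (face a b c) = (a * 32 + b * 16 + c * 8)%N.
Proof.
rewrite /code_nat !big_ord_recl big_ord0 !ffunE !inordK //=.
by case: a b c => [] [] [].
Qed.

Lemma third_difference_permuted :
  third_difference (fun a b c => F (p_tilde (face a b c))) = 3%:Z.
Proof. by rewrite /third_difference !F_p_tilde !code_face. Qed.

Lemma not_sum_of_bivariates_F_p_tilde (R : realType) :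
  ~ sum_of_bivariates (Omega := fun _ : 'I_6 => bool)
      (fun x : cube => (F (p_tilde x))%:~R : R).
Proof.
move=> /(third_difference_eq0 (fun i => inord (minn i 2))
  [ffun=> false] [ffun i : 'I_6 => (i < 3)%N]).
have : (third_difference (fun a b c => F (p_tilde (face a b c))))%:~R != 0 :> R.
  by rewrite third_difference_permuted pnatr_eq0.
by rewrite /third_difference !(rmorphB, rmorphD) /= => /eqP.
Qed.

Theorem mainTheorem4 (R : realType) :
  [/\ ~ (forall (n : nat) (Omega : 'I_n -> finType)
           (H : {dffun forall i : 'I_n, Omega i} -> R)
           (s : {perm {dffun forall i : 'I_n, Omega i}}),
           sum_of_bivariates H -> sum_of_bivariates (fun x => H (s x))),
      sum_of_bivariates (Omega := fun _ : 'I_6 => bool)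
        (fun x : cube => (F x)%:~R : R) &
      ~ sum_of_bivariates (Omega := fun _ : 'I_6 => bool)
          (fun x : cube => (F (p_tilde x))%:~R : R)].
Proof.
split; first 1 last.
- exact: sum_of_bivariates_F.
- exact: not_sum_of_bivariates_F_p_tilde.
move=> closed; apply: (@not_sum_of_bivariates_F_p_tilde R).
exact: (closed 6 _ _ p_tilde (sum_of_bivariates_F R)).
Qed.
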